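(* Let $X,Y$ be real-valued random variables on an atomless probability space (no integrability assumed). The following are equivalent: (i) $X\le^\dagger_{\rm cx} Y$; (ii) for all $p\in(0,1)$, $$\int_0^p F_X^{-1}(t)\,\mathrm dt \ge \int_0^p F_Y^{-1}(t)\,\mathrm dt \quad\text{and}\quad \int_p^1 F_X^{-1}(t)\,\mathrm dt \le \int_p^1 F_Y^{-1}(t)\,\mathrm dt,$$ where each of these inequalities between elements of $[-\infty,\infty]$ is considered true whenever it has the form $\infty\le x$ or $x\le-\infty$ for some $x\in[-\infty,\infty]$; (iii) for all $w\in\mathbb R$, $$\mathbb E[(X-w)_-]\le \mathbb E[(Y-w)_-]\quad\text{and}\quad \mathbb E[(X-w)_+]\le \mathbb E[(Y-w)_+],$$ with the same convention that an inequality of the form $\infty\le x$ or $x\le -\infty$, $x\in[-\infty,\infty]$, is considered true.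
   Context: For $x\in\mathbb R$, $x_+=\max\{x,0\}$, $x_-=\max\{-x,0\}$. $\mathcal U_{\rm cx}$ is the set of all convex functions $\mathbb R\to\mathbb R$. We write $X\le^\dagger_{\rm cx}Y$ (the ''$^\dagger$convex order'') if $\mathbb E[u(X)]\le \mathbb E[u(Y)]$ for all $u\in\mathcal U_{\rm cx}$ such that both expectations $\mathbb E[u(X)]$ and $\mathbb E[u(Y)]$ are finite. $F_X^{-1}(t)=\inf\{x\in\mathbb R:\mathbb P(X\le x)\ge t\}$, $t\in(0,1)$, is the left quantile function. *)

(* Defs.v *)
From HB Require Import structures.
From mathcomp Require Import all_boot all_order all_algebra.
From mathcomp Require Import all_classical all_reals all_analysis.
Set Implicit Arguments. Unset Strict Implicit. Unset Printing Implicit Defensive.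
Import Order.TTheory GRing.Theory Num.Theory.
Local Open Scope classical_set_scope.
Local Open Scope ring_scope.

Definition convex_fun (R : realType) (u : R -> R) : Prop :=
  forall (x y t : R), 0 <= t -> t <= 1 ->
    u (t * x + (1 - t) * y) <= t * u x + (1 - t) * u y.

Definition atomless (d : measure_display) (T : measurableType d) (R : realType)
  (P : probability T R) : Prop :=
  forall A : set T, measurable A -> (0 < P A)%E ->
    exists B : set T, [/\ measurable B, B `<=` A, (0 < P B)%E & (P B < P A)%E].

Definition lquantile (d : measure_display) (T : measurableType d) (R : realType)
  (P : probability T R) (X : T -> R) (t : R) : R :=
  inf [set x : R | (t%:E <= P [set w | (X w <= x)%R])%E].

Definition dagger_cx (d : measure_display) (T : measurableType d) (R : realType)
  (P : probability T R) (X Y : T -> R) : Prop :=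
  forall u : R -> R, convex_fun u ->
    P.-integrable setT (EFin \o (u \o X)) ->
    P.-integrable setT (EFin \o (u \o Y)) ->
    (\int[P]_w (u (X w))%:E <= \int[P]_w (u (Y w))%:E)%E.

Definition ele_conv (R : realType) (a b : \bar R) : Prop :=
  a = +oo%E \/ b = -oo%E \/ (a <= b)%E.

Definition neg_part (R : realType) (x : R) : R := Num.max (- x) 0.
Definition pos_part (R : realType) (x : R) : R := Num.max x 0.

(* Main.v *)
(* (i) <-> (iii). Hinges are convex, so (i) gives (iii). Conversely, for a convex [u] and
   any point [m], the function [(u - u m)_+] is the sum of a nondecreasing convex function
   vanishing left of [m] and of the mirror image of such a function; each of them is the
   limit from below of finite nonnegative combinations of hinges. Hence
   [E (u X) <= E (max (u Y) (u m))], and letting [u m] decrease to the infimum of [u] gives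
   [E (u X) <= E (u Y)]. Nothing but the integrability of [u X] and [u Y] is used, which is
   why no integrability of [X] or [Y] is needed.

   (ii) <-> (iii). The quantile function [q] has under Lebesgue measure on ]0,1[ the law of
   [X], so that [E (X - w)_+] is the integral of [(q - w)_+]. For all [p] and [w] this is at
   least [int_]p,1[ q - (1 - p) w], with equality when [w = q p] or [p = F w]; so tail
   integrals and hinge expectations are Legendre dual and order each other. The lower tails
   are the same duality for [- q] and the sets ]0,p]. *)

Require Import Defs.
From HB Require Import structures.
From mathcomp Require Import all_boot all_order all_algebra.
From mathcomp Require Import all_classical all_reals all_analysis.
From mathcomp Require Import measurable_realfun ring lra.
Import Order.TTheory GRing.Theory Num.Theory.
Import numFieldNormedType.Exports.
Set Implicit Arguments. Unset Strict Implicit. Unset Printing Implicit Defensive.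
Local Open Scope classical_set_scope.
Local Open Scope ring_scope.

(** * Tail integrals against hinge integrals on an abstract measure space *)

Section duality.
Context {d} {T : measurableType d} {R : realType}.
Context (mu : {measure set T -> \bar R}).

(** Such an [S] is a superlevel set of [f] in [D] up to ties: points where [f] equals [w] may lie on
    either side. This tolerance is what allows flat pieces of a quantile function. *)
Definition straddles (D S : set T) (f : T -> R) (w : R) : Prop :=
  (forall t, S t -> w <= f t) /\ (forall t, D t -> ~ S t -> f t <= w).

Lemma pos_part_ge0 (x : R) : 0 <= pos_part x.
Proof. by rewrite /pos_part le_max lexx orbT. Qed.

Lemma pos_part_ge (x : R) : x <= pos_part x.
Proof. by rewrite /pos_part le_max lexx. Qed.

Lemma measurable_pos_part (D : set T) (f : T -> R) (w : R) : measurable_fun D f ->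
  measurable_fun D (fun t => (pos_part (f t - w))%:E).
Proof.
move=> mf; apply/measurable_EFinP; apply: measurable_maxr => //.
exact: measurable_funB.
Qed.

Lemma integral_pos_part_straddles (D S : set T) (f : T -> R) (w : R) :
  S `<=` D -> straddles D S f w ->
  (\int[mu]_(t in D) (pos_part (f t - w))%:E = \int[mu]_(t in S) (f t - w)%:E)%E.
Proof.
move=> SD [Sw DSw]; rewrite [LHS]integral_mkcond [RHS]integral_mkcond.
apply: eq_integral => t _; rewrite !patchE.
have [tS|tS] := boolP (t \in S).
  move: tS; rewrite inE => tS; rewrite mem_set; last exact: SD.
  by rewrite /pos_part max_l// subr_ge0 Sw.
case: ifPn => // tD; move: tD tS; rewrite !inE notin_setE => tD tS.
by rewrite /pos_part max_r// subr_le0 DSw.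
Qed.

Lemma finite_integrable_cst (S : set T) (w : R) :
  measurable S -> (mu S < +oo)%E -> mu.-integrable S (EFin \o cst w).
Proof.
move=> mS Sfin; apply: measurable_bounded_integrable => //.
exists `|w|; split; first exact: num_real.
by move=> M wM t _ /=; exact: ltW.
Qed.

Lemma integral_funeneg_lt_pinfty_ge_cst (S : set T) (f : T -> R) (w : R) :
  measurable S -> (mu S < +oo)%E -> measurable_fun S f ->
  (forall t, S t -> w <= f t) -> (\int[mu]_(t in S) (EFin \o f)^\- t < +oo)%E.
Proof.
move=> mS Sfin mf wf; have /integrableP[_] := finite_integrable_cst w mS Sfin.
apply: le_lt_trans; apply: ge0_le_integral => //.
- by apply: measurable_funeneg; exact/measurable_EFinP.
- apply: measurableT_comp => //; apply/measurable_EFinP; exact: measurable_cst.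
move=> t St; rewrite funenegE /= -EFin_max lee_fin ge_max normr_ge0 andbT.
by rewrite lerNl (le_trans _ (wf t St))// lerNl -normrN ler_norm.
Qed.

(** The lower bound and the finite measure make the negative part integrable, so a signed integral
    below [+oo] forces the positive part to be integrable as well. *)
Lemma integrable_ge_cst (S : set T) (f : T -> R) (w : R) :
  measurable S -> (mu S < +oo)%E -> measurable_fun S f ->
  (forall t, S t -> w <= f t) -> (\int[mu]_(t in S) (f t)%:E < +oo)%E ->
  mu.-integrable S (EFin \o f).
Proof.
move=> mS Sfin mf wf; have mF : measurable_fun S (EFin \o f) by exact/measurable_EFinP.
have negfin := integral_funeneg_lt_pinfty_ge_cst mS Sfin mf wf.
rewrite integralE => posfin; apply/integrableP; split => //.
have -> : (fun x => `|(EFin \o f) x|%E) = ((EFin \o f)^\+ \+ (EFin \o f)^\-)%E.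
  by rewrite -fune_abse.
rewrite ge0_integralD//; [|exact: measurable_funepos|exact: measurable_funeneg].
apply: lte_add_pinfty => //; move: posfin negfin.
set a := (\int[mu]_(x in S) _^\+ x)%E; set b := (\int[mu]_(x in S) _^\- x)%E.
have : (0 <= b)%E by exact: integral_ge0.
move=> b0 + boo; rewrite lteBlDr ?ge0_fin_numE// => /lt_le_trans; apply; exact: leey.
Qed.

Lemma integrableB_cst (S : set T) (f : T -> R) (w : R) :
  measurable S -> (mu S < +oo)%E -> mu.-integrable S (EFin \o f) ->
  mu.-integrable S (fun t => (f t - w)%:E).
Proof. by move=> mS Sfin fi; exact: (integrableB mS fi (finite_integrable_cst w mS Sfin)). Qed.

Lemma integralB_cst (S : set T) (f : T -> R) (w : R) :
  measurable S -> (mu S < +oo)%E -> mu.-integrable S (EFin \o f) ->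
  (\int[mu]_(t in S) (f t - w)%:E = \int[mu]_(t in S) (f t)%:E - w%:E * mu S)%E.
Proof.
move=> mS Sfin fi.
by rewrite integralB_EFin// ?integral_cst//; exact: finite_integrable_cst.
Qed.

(** Moving the level from [w] to [v] raises the hinge by at most [|w - v|], which has a finite
    integral over [D]. *)
Lemma integral_pos_part_finite (D : set T) (f : T -> R) (w v : R) :
  measurable D -> (mu D < +oo)%E -> measurable_fun D f ->
  (\int[mu]_(t in D) (pos_part (f t - w))%:E < +oo)%E ->
  (\int[mu]_(t in D) (pos_part (f t - v))%:E < +oo)%E.
Proof.
move=> mD Dfin mf fw.
have mfp u := measurable_pos_part u mf.
apply: (@le_lt_trans _ _ (\int[mu]_(t in D) ((pos_part (f t - w))%:E + `|w - v|%:E))%E).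
  apply: ge0_le_integral => //.
  - by move=> t _; rewrite lee_fin pos_part_ge0.
  - by apply: emeasurable_funD; [exact: mfp|exact: measurable_cst].
  move=> t _; rewrite -EFinD lee_fin {1}/pos_part ge_max addr_ge0 ?pos_part_ge0// andbT.
  rewrite (_ : f t - v = (f t - w) + (w - v)); last by ring.
  by rewrite lerD ?pos_part_ge ?ler_norm.
rewrite ge0_integralD//; first last.
- by move=> t _; rewrite lee_fin pos_part_ge0.
apply: lte_add_pinfty => //; rewrite integral_cst//.
by rewrite lte_mul_pinfty.
Qed.

(** The convention leaves something to prove only when both sides are below [+oo]; either of them
    may still be [-oo]. *)
Lemma ele_conv_lty (a b : \bar R) : (a < +oo -> b < +oo -> a <= b)%E -> ele_conv a b.
Proof.
move=> ab; have [->|a_fin] := eqVneq a +oo%E; first by left.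
have [->|b_fin] := eqVneq b +oo%E; first by right; right; rewrite leey.
by right; right; apply: ab; rewrite ltey.
Qed.

Lemma ele_conv_le (a b : \bar R) : ele_conv a b -> (a < +oo -> -oo < b -> a <= b)%E.
Proof. by move=> [->|[->|//]]; rewrite ltxx. Qed.

(** The Fenchel-Young inequality of the duality: [f - w] is below its positive part on [S], and
    enlarging [S] to [D] only adds nonnegative mass. Equality holds when [S] straddles [w], by
    [integral_pos_part_straddles]. *)
Lemma integral_le_pos_part (D S : set T) (f : T -> R) (w : R) :
  measurable D -> measurable S -> S `<=` D -> (mu S < +oo)%E -> measurable_fun D f ->
  mu.-integrable S (EFin \o f) ->
  (\int[mu]_(t in S) (f t)%:E - w%:E * mu S <=
   \int[mu]_(t in D) (pos_part (f t - w))%:E)%E.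
Proof.
move=> mD mS SD Sfin mf fi; rewrite -integralB_cst//.
have mfp := measurable_pos_part w mf.
apply: (@le_trans _ _ (\int[mu]_(t in S) (pos_part (f t - w))%:E)%E); last first.
  by apply: ge0_subset_integral => // t _; rewrite lee_fin pos_part_ge0.
have [->|fin] := eqVneq (\int[mu]_(t in S) (pos_part (f t - w))%:E)%E +oo%E.
  by rewrite leey.
apply: le_integral => //.
- exact: integrableB_cst.
- apply/integrableP; split; first exact: measurable_funS mfp.
  under eq_integral do rewrite gee0_abs ?lee_fin ?pos_part_ge0//.
  by rewrite ltey.
- by move=> t _; rewrite lee_fin pos_part_ge.
Qed.

(** At the straddled level [w] the hinge integral is the integral of [f - w] over [S]. Passing to
    another level [v], or from [f - w] to [f], costs only a constant on a set of finite measure. *)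
Lemma integrable_straddles (D S : set T) (f : T -> R) (w v : R) :
  measurable D -> (mu D < +oo)%E -> measurable_fun D f ->
  measurable S -> S `<=` D -> straddles D S f w ->
  mu.-integrable S (EFin \o f) <-> (\int[mu]_(t in D) (pos_part (f t - v))%:E < +oo)%E.
Proof.
move=> mD Dfin mf mS SD fw.
have Sfin : (mu S < +oo)%E by apply: le_lt_trans Dfin; rewrite le_measure ?inE.
have mfS : measurable_fun S f by exact: measurable_funS mf.
split => [fi|fv].
  apply: (@integral_pos_part_finite _ _ w) => //.
  rewrite (integral_pos_part_straddles SD fw).
  by apply: integrable_lty => //; exact: integrableB_cst.
have fwi : mu.-integrable S (fun t => (f t - w)%:E).
  apply: (@integrable_ge_cst _ _ 0) => //; first exact: measurable_funB.
    by move=> t St; rewrite subr_ge0 (proj1 fw).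
  rewrite -(integral_pos_part_straddles SD fw).
  exact: (@integral_pos_part_finite _ _ v).
have -> : EFin \o f = (fun t => (f t - w)%:E + (EFin \o cst w) t)%E.
  by apply/funext => t /=; rewrite -EFinD subrK.
by apply: integrableD => //; exact: finite_integrable_cst.
Qed.

(** The hinge order is used at the level [wg] that [g] straddles on [S]: there the Fenchel-Young
    inequality is an equality for [g], while for [f] the inequality suffices. *)
Lemma ele_conv_straddles (D S : set T) (f g : T -> R) (wf wg : R) :
  measurable D -> (mu D < +oo)%E -> measurable_fun D f -> measurable_fun D g ->
  measurable S -> S `<=` D -> straddles D S f wf -> straddles D S g wg ->
  (forall w, ele_conv (\int[mu]_(t in D) (pos_part (f t - w))%:E)
                      (\int[mu]_(t in D) (pos_part (g t - w))%:E)) ->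
  ele_conv (\int[mu]_(t in S) (f t)%:E) (\int[mu]_(t in S) (g t)%:E).
Proof.
move=> mD Dfin mf mg mS SD fS gS fg.
have Sfin : (mu S < +oo)%E by apply: le_lt_trans Dfin; rewrite le_measure ?inE.
have mfS : measurable_fun S f by exact: measurable_funS mf.
have mgS : measurable_fun S g by exact: measurable_funS mg.
apply: ele_conv_lty => foo goo.
have fi : mu.-integrable S (EFin \o f).
  by apply: (integrable_ge_cst _ _ _ (proj1 fS)).
have gi : mu.-integrable S (EFin \o g).
  by apply: (integrable_ge_cst _ _ _ (proj1 gS)).
have cfin : (- (wg%:E * mu S) \is a fin_num)%E.
  by rewrite fin_numN fin_numM// ge0_fin_numE.
rewrite -(leeD2rE _ _ cfin) -[leRHS]integralB_cst// -(integral_pos_part_straddles SD gS).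
apply: le_trans (integral_le_pos_part wg mD mS SD Sfin mf fi) _.
apply: (ele_conv_le (fg wg)).
  exact: (iffLR (integrable_straddles wg mD Dfin mf mS SD fS) fi).
apply: (@lt_le_trans _ _ 0%E) => //; apply: integral_ge0 => t _.
by rewrite lee_fin pos_part_ge0.
Qed.

(* Where [f] straddles [w] on no set of the family, [f - w] has constant sign on [D];
   the positive sign is reached along the exhaustion [E]. *)
Lemma ele_conv_pos_part (I : Type) (F : I -> set T) (D : set T) (f g : T -> R) (w : R)
    (e : nat -> I) :
  measurable D -> (mu D < +oo)%E -> measurable_fun D f -> measurable_fun D g ->
  (forall i, measurable (F i)) -> (forall i, F i `<=` D) ->
  (forall i, exists v, straddles D (F i) f v) ->
  (forall i, exists v, straddles D (F i) g v) ->
  nondecreasing_seq (fun n => F (e n)) -> \bigcup_n F (e n) = D ->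
  [\/ forall t, D t -> f t <= w, exists i, straddles D (F i) f w |
      forall t, D t -> w <= f t] ->
  (forall i, ele_conv (\int[mu]_(t in F i) (f t)%:E) (\int[mu]_(t in F i) (g t)%:E)) ->
  ele_conv (\int[mu]_(t in D) (pos_part (f t - w))%:E)
           (\int[mu]_(t in D) (pos_part (g t - w))%:E).
Proof.
move=> mD Dfin mf mg mF FD fF gF ndF FE fw fg.
apply: ele_conv_lty => foo goo.
have main i : (\int[mu]_(t in F i) (f t - w)%:E <=
               \int[mu]_(t in D) (pos_part (g t - w))%:E)%E.
  have Ffin : (mu (F i) < +oo)%E.
    by apply: le_lt_trans Dfin; rewrite le_measure ?inE//; exact: FD.
  have [vf fv] := fF i; have [vg gv] := gF i.
  (* Both hinge integrals being finite, both tail integrals are finite, so the convention in [fg i]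
     reduces to a true inequality. *)
  have fi : mu.-integrable (F i) (EFin \o f) by exact/(integrable_straddles w mD Dfin mf _ _ fv).
  have gi : mu.-integrable (F i) (EFin \o g) by exact/(integrable_straddles w mD Dfin mg _ _ gv).
  apply: le_trans (integral_le_pos_part w mD (mF i) (FD i) Ffin mg gi).
  rewrite integralB_cst// leeB//.
  apply: (ele_conv_le (fg i)); first exact: integrable_lty.
  by have /fin_numPlt/andP[] := integrable_fin_num (mF i) gi.
case: fw => [fw|[i fw]|fw].
- rewrite (eq_integral (cst 0%E)) ?integral0.
    by apply: integral_ge0 => t _; rewrite lee_fin pos_part_ge0.
  by move=> t; rewrite inE => Dt; rewrite /pos_part max_r// subr_le0 fw.
- by rewrite (integral_pos_part_straddles (FD i) fw).
have -> : (\int[mu]_(t in D) (pos_part (f t - w))%:E = \int[mu]_(t in D) (f t - w)%:E)%E.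
  by apply: integral_pos_part_straddles.
have mfw : measurable_fun D (fun t => (f t - w)%:E).
  by apply/measurable_EFinP; exact: measurable_funB.
have cvF : (\int[mu]_(t in F (e n)) (f t - w)%:E @[n --> \oo] -->
            \int[mu]_(t in \bigcup_n F (e n)) (f t - w)%:E)%E.
  apply: ge0_nondecreasing_set_cvg_integral => //.
  - by move=> n; apply: measurable_funS mfw => //; exact: FD.
  - by move=> n t /FD Dt; rewrite lee_fin subr_ge0 fw.
rewrite FE in cvF; rewrite -(cvg_lim _ cvF)//; apply: lime_le.
  by apply/cvg_ex; eexists; exact: cvF.
by apply: nearW => n; exact: main.
Qed.

(** An abstract family [F] lets one proof serve the upper tails of [q] and, through [- q], the lower
    tails. The three cases on [w] concern [f] alone: its hinge integral must be computed exactly,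
    whereas that of [g] is only bounded from below. *)
Lemma ele_conv_duality (I : Type) (F : I -> set T) (D : set T) (f g : T -> R)
    (e : nat -> I) :
  measurable D -> (mu D < +oo)%E -> measurable_fun D f -> measurable_fun D g ->
  (forall i, measurable (F i)) -> (forall i, F i `<=` D) ->
  (forall i, exists v, straddles D (F i) f v) ->
  (forall i, exists v, straddles D (F i) g v) ->
  nondecreasing_seq (fun n => F (e n)) -> \bigcup_n F (e n) = D ->
  (forall w, [\/ forall t, D t -> f t <= w, exists i, straddles D (F i) f w |
                 forall t, D t -> w <= f t]) ->
  (forall i, ele_conv (\int[mu]_(t in F i) (f t)%:E) (\int[mu]_(t in F i) (g t)%:E)) <->
  (forall w, ele_conv (\int[mu]_(t in D) (pos_part (f t - w))%:E)
                      (\int[mu]_(t in D) (pos_part (g t - w))%:E)).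
Proof.
move=> mD Dfin mf mg mF FD fF gF ndF FE fw; split=> [fg w|fg i].
  exact: (ele_conv_pos_part mD Dfin mf mg mF FD fF gF ndF FE).
have [vf fv] := fF i; have [vg gv] := gF i.
exact: (ele_conv_straddles mD Dfin mf mg _ _ fv gv).
Qed.

End duality.

(** * The left quantile function and its law *)

Section quantile.
Context {d} {T : measurableType d} {R : realType} (P : probability T R).
Variable X : {RV P >-> R}.

Lemma cdfE (x : R) : cdf X x = P [set s | X s <= x].
Proof. by congr (P _). Qed.

(** The Galois connection between quantile and distribution function. The limits of the cdf at [+oo]
    and [-oo] make the defining set nonempty and bounded below; right continuity makes it contain
    its infimum. *)
Lemma lquantile_le (t x : R) : 0 < t -> t < 1 ->
  (lquantile P X t <= x) = (t%:E <= cdf X x)%E.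
Proof.
move=> t0 t1; rewrite /lquantile.
have -> : [set x0 | (t%:E <= P [set w | (X w <= x0)%R])%E] = [set y | (t%:E <= cdf X y)%E].
  by apply/seteqP; split => y /=; rewrite cdfE.
set A := [set y | _].
have A0 : A !=set0.
  apply: contrapT => A0; suff : (1 <= t%:E)%E by rewrite lee_fin leNgt t1.
  apply: cvge_le (cvg_cdfy1 X); apply: nearW => y; rewrite leNgt; apply/negP => yA.
  by apply: A0; exists y; exact: ltW.
have [m mt] : exists m, (cdf X m < t%:E)%E.
  apply: contrapT => mA; suff : (t%:E <= 0)%E by rewrite lee_fin leNgt t0.
  apply: cvge_ge (cvg_cdfNy0 X); apply: nearW => y; rewrite leNgt; apply/negP => yA.
  by apply: mA; exists y.
have lbA : has_lbound A.
  exists m => y Ay; rewrite leNgt; apply/negP => ym.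
  move: mt; rewrite ltNge => /negP; apply.
  by apply: le_trans Ay _; exact/cdf_nondecreasing/ltW.
have Ainf : A (inf A).
  have := @cdf_right_continuous _ _ _ P X (inf A).
  apply: cvge_ge; near=> r.
  (* Every [r > inf A] exceeds a point of [A], hence [cdf X r] is at least [t]; the limit from the
     right carries this to [inf A]. *)
  have [e Ae er] : exists2 e, A e & e < inf A + (r - inf A).
    apply: inf_adherent; last by split.
    by rewrite subr_gt0; near: r; exact: nbhs_right_gt.
  apply: le_trans Ae _; apply: cdf_nondecreasing; apply: ltW.
  by rewrite addrC subrK in er.
apply/idP/idP => [Ax|Ax]; last exact: ge_inf.
by apply: le_trans Ainf _; exact: cdf_nondecreasing.
Unshelve. all: by end_near. Qed.

Lemma lquantile_nondecreasing :
  {in `]0, 1[ &, nondecreasing_fun (lquantile P X)}.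
Proof.
move=> s t; rewrite !in_itv/= => /andP[s0 s1] /andP[t0 t1] st.
by rewrite lquantile_le// (le_trans (y := t%:E))// -?lquantile_le// lee_fin.
Qed.

Lemma measurable_lquantile : measurable_fun (`]0%R, 1%R[ : set R) (lquantile P X).
Proof.
apply: (measurability (@RGenCInfty.G R)) => [|_ [_ [r ->] <-]].
  exact: RGenCInfty.measurableE.
(* By monotonicity the preimage of an upper ray is an interval. *)
apply: is_interval_measurable => s t /=.
rewrite !in_itv/= !andbT => -[s01 fs] [t01 ft] u /andP[su ut].
have u01 : u \in `]0, 1[.
  move: s01 t01; rewrite !in_itv/= => /andP[s0 _] /andP[_ t1].
  by rewrite (lt_le_trans s0)//= (le_lt_trans ut).
split=> //; rewrite in_itv/= andbT (le_trans fs)//.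
by apply: lquantile_nondecreasing.
Qed.

(** The law of [X] and the image of Lebesgue measure on []0, 1[] under the quantile function agree
    on the rays []x, +oo[], which are stable under intersection and exhaust the line, hence on all
    measurable sets. *)
Lemma ge0_integral_lquantile (h : R -> \bar R) : measurable_fun setT h ->
  (forall x, 0 <= h x)%E ->
  (\int[P]_s h (X s) = \int[lebesgue_measure]_(t in `]0%R, 1%R[) h (lquantile P X t))%E.
Proof.
move=> mh h0.
pose D : set (measurableTypeR R) := `]0%R, 1%R[%classic.
have mD : measurable D by exact: measurable_itv.
(* A total measurable function is required for the image measure. The value 0 outside [D] is
   harmless, as [m0] gives no mass there. *)
pose q : measurableTypeR R -> R := lquantile P X \_ D.
have mq : measurable_fun setT q by apply/(measurable_restrictT _ mD); exact: measurable_lquantile.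
pose m0 : {measure set (measurableTypeR R) -> \bar R} := mrestr (@lebesgue_measure R) mD.
pose m_ : {measure set R -> \bar R} := pushforward m0 q.
pose m := m_ mq.
have law A : measurable A -> distribution P X A = m A.
  move=> mA; apply: (measure_unique (@RGenOInfty.G R) (fun n => `](- n%:R), +oo[%classic)) mA.
  - exact: RGenOInfty.measurableE.
  - move=> _ _ [x ->] [y ->]; exists (Num.max x y).
    by apply/seteqP; split => z /=; rewrite !in_itv/= !andbT gt_max; [move=> [-> ->]|move/andP].
  - by move=> n; eexists.
  - rewrite -subTset => x _; exists (Num.bound x) => //=.
    by rewrite in_itv/= andbT ltrNl unstable.ltrNbound.
  - move=> _ [x ->]; rewrite -[LHS]/(ccdf X x) ccdf_1_cdf.
    have cfin : cdf X x \is a fin_num by exact: fin_num_measure.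
    rewrite /m /m_ /= /pushforward /m0 /mrestr.
    have -> : q @^-1` `]x, +oo[ `&` D = `]fine (cdf X x), 1%R[%classic.
      apply/seteqP; split => t /=.
        move=> [+ tD]; rewrite /q patchE mem_set// in_itv/= andbT ltNge.
        move: tD; rewrite /D/= in_itv/= => /andP[t0 t1]; rewrite lquantile_le// -ltNge.
        by rewrite in_itv/= t1 andbT -lte_fin fineK.
      rewrite in_itv/= => /andP[xt t1].
      have t0 : 0 < t by apply: le_lt_trans xt; rewrite fine_ge0// cdf_ge0.
      have tD : D t by rewrite /D/= in_itv/= t0.
      split => //; rewrite /q patchE mem_set// in_itv/= andbT ltNge lquantile_le// -ltNge.
      by rewrite -[cdf X x]fineK// lte_fin.
    rewrite lebesgue_measure_itv/= lte_fin; case: ltP => [_|].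
      by rewrite EFinN fineK.
    (* If the cdf reaches 1 at [x], the interval is empty and the ray has probability 0. *)
    rewrite -lee_fin fineK// => c1.
    have -> : cdf X x = 1%E by apply/eqP; rewrite eq_le cdf_le1.
    by rewrite subee.
  - by move=> k; apply: le_lt_trans (probability_le1 _ _) _ => //; rewrite ltry.
rewrite -[LHS]/(\int[P]_s (h \o X) s)%E -ge0_integral_distribution//.
rewrite (eq_measure_integral m); last by move=> A mA _; exact: law.
rewrite ge0_integral_pushforward//.
rewrite preimage_setT (@ge0_negligible_integral _ _ _ _ _ (~` D))//.
- rewrite setTD setCK (eq_measure_integral (@lebesgue_measure R)).
    by apply: eq_integral => t tD; rewrite /q /= patchE tD.
  by move=> A mA AD; rewrite /m0 /= /mrestr setIidl.
- exact: measurableC.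
- exact: measurableT_comp.
- by move=> t _; exact: h0.
- by rewrite -[LHS]/(lebesgue_measure (~` D `&` D)) setICl measure0.
Qed.

End quantile.

(** * Quantile tails against hinge expectations *)

Lemma ele_convN (R : realType) (a b : \bar R) :
  ele_conv (- a)%E (- b)%E <-> ele_conv b a.
Proof.
rewrite /ele_conv leeN2.
have -> : (- a = +oo)%E = (a = -oo)%E.
  by apply/propext; split=> [/eqP|->//]; rewrite eqe_oppLR => /eqP.
have -> : (- b = -oo)%E = (b = +oo)%E.
  by apply/propext; split=> [/eqP|->//]; rewrite eqe_oppLR => /eqP.
tauto.
Qed.

(** The upper bound keeps the integral of the positive part finite, so the integral is never of the
    form [+oo - +oo] and negation commutes with it. *)
Lemma integralN_le_cst {d} {T : measurableType d} {R : realType}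
    (mu : {measure set T -> \bar R}) (S : set T) (f : T -> R) (w : R) :
  measurable S -> (mu S < +oo)%E -> measurable_fun S f -> (forall t, S t -> f t <= w) ->
  (\int[mu]_(t in S) (- f t)%:E = - \int[mu]_(t in S) (f t)%:E)%E.
Proof.
move=> mS Sfin mf fw; rewrite -integralN//; apply: fin_num_adde_defr.
have mNf : measurable_fun S (fun t => - f t) by exact: measurable_funN.
rewrite ge0_fin_numE; last exact: integral_ge0.
have -> : (fun t => (f t)%:E) = (\- (EFin \o (fun t => - f t)%R))%E.
  by apply/funext => t /=; rewrite opprK.
rewrite funeposN.
apply: (@integral_funeneg_lt_pinfty_ge_cst _ _ _ _ _ _ (- w)) => // t St.
by rewrite lerN2 fw.
Qed.

Section quantile_duality.
Context {d} {T : measurableType d} {R : realType} (P : probability T R).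
Implicit Types X Y : {RV P >-> R}.

Let D : set R := `]0%R, 1%R[%classic.
(** The offset 2 keeps [u n] and [1 - u n] strictly inside []0, 1[] already for [n = 0], so that
    both are admissible indices in [I]. *)
Let u (n : nat) : R := n.+2%:R^-1.

Let u01 n : 0 < u n < 1.
Proof. by rewrite invr_gt0 ltr0n /= invf_lt1 ?ltr0n// ltr1n. Qed.

Let v01 n : 0 < 1 - u n < 1.
Proof. by have /andP[u0 u1] := u01 n; rewrite subr_gt0 u1 gtrBl. Qed.

Let u_small (e : R) : 0 < e -> exists n, u n < e.
Proof.
move=> e0; exists (Num.bound e^-1); rewrite invf_plt ?posrE ?ltr0n//.
by apply: lt_trans (unstable.ltr_bound _) _; rewrite ltr_nat.
Qed.

Let u_nonincreasing m n : (m <= n)%N -> u n <= u m.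
Proof. by move=> mn; rewrite lef_pV2 ?posrE ?ltr0n// ler_nat !ltnS. Qed.

Let lebesgueD : (lebesgue_measure D < +oo)%E.
Proof. by rewrite lebesgue_measure_itv /= lte_fin ltr01 ltry. Qed.

Let I := {p : R | 0 < p < 1}.

Let mkI (p : R) (p01 : 0 < p < 1) : I := exist _ p p01.

(** The cases are those of [cdf X w]: equal to 1, strictly between 0 and 1 (and then it is the index
    [p]), or equal to 0. *)
Lemma lquantile_trichotomy X (w : R) :
  [\/ forall t, D t -> lquantile P X t <= w,
      exists p : I, forall t, D t -> (lquantile P X t <= w) = (t <= sval p) |
      forall t, D t -> w < lquantile P X t].
Proof.
have cfin : cdf X w \is a fin_num by exact: fin_num_measure.
have qc t : D t -> (lquantile P X t <= w) = (t <= fine (cdf X w)).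
  by rewrite /D/= in_itv/= => /andP[t0 t1]; rewrite lquantile_le// -lee_fin fineK.
have [c0|c0] := leP (fine (cdf X w)) 0.
  apply: Or33 => t Dt; rewrite ltNge qc// -ltNge; apply: le_lt_trans c0 _.
  by move: Dt; rewrite /D/= in_itv/= => /andP[].
have [c1|c1] := leP 1 (fine (cdf X w)).
  apply: Or31 => t Dt; rewrite qc//; apply: le_trans c1; apply: ltW.
  by move: Dt; rewrite /D/= in_itv/= => /andP[].
have c01 : 0 < fine (cdf X w) < 1 by rewrite c0.
by apply: Or32; exists (mkI c01).
Qed.

Let integral_RV X (h : R -> R) : measurable_fun setT h -> (forall x, 0 <= h x) ->
  (\int[P]_s (h (X s))%:E = \int[lebesgue_measure]_(t in D) (h (lquantile P X t))%:E)%E.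
Proof.
move=> mh h0; apply: (@ge0_integral_lquantile _ _ _ P X (EFin \o h)).
  exact/measurable_EFinP.
by move=> x; rewrite lee_fin.
Qed.

Lemma lquantile_upper_duality X Y :
  (forall p : R, 0 < p -> p < 1 ->
    ele_conv (\int[lebesgue_measure]_(t in (`]p, 1%R[ : set R)) (lquantile P X t)%:E)%E
             (\int[lebesgue_measure]_(t in (`]p, 1%R[ : set R)) (lquantile P Y t)%:E)%E) <->
  (forall w : R,
    ele_conv (\int[P]_s (pos_part (X s - w))%:E)%E (\int[P]_s (pos_part (Y s - w))%:E)%E).
Proof.
have posE (Z : {RV P >-> R}) w : (\int[P]_s (pos_part (Z s - w))%:E =
    \int[lebesgue_measure]_(t in D) (pos_part (lquantile P Z t - w))%:E)%E.
  apply: (@integral_RV Z (fun x => pos_part (x - w))) => [|x]; last exact: pos_part_ge0.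
  by apply: measurable_maxr => //; exact: measurable_funB.
pose F (p : I) : set R := `]sval p, 1%R[%classic.
have FE p t : D t -> F p t = (sval p < t) :> Prop.
  by rewrite /F /D/= !in_itv/= => /andP[_ ->]; rewrite andbT.
have FD p : F p `<=` D.
  move=> t; rewrite /F /D/= !in_itv/= => /andP[pt ->]; rewrite andbT.
  by apply: lt_trans pt; have /andP[] := svalP p.
have straddleF (Z : {RV P >-> R}) (p : I) : exists v, straddles D (F p) (lquantile P Z) v.
  have p01 : sval p \in `]0, 1[ by rewrite in_itv/= (svalP p).
  exists (lquantile P Z (sval p)); split => [t Ft|t Dt].
    have Dt := FD _ _ Ft; move: Ft; rewrite FE// => pt.
    by apply: lquantile_nondecreasing => //; exact: ltW.
  rewrite FE// => /negP; rewrite -leNgt => tp.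
  exact: lquantile_nondecreasing.
have dual := @ele_conv_duality _ _ _ lebesgue_measure I F D (lquantile P X) (lquantile P Y)
  (fun n => mkI (u01 n)) (measurable_itv _) lebesgueD (@measurable_lquantile _ _ _ P X)
  (@measurable_lquantile _ _ _ P Y) (fun p => measurable_itv _) FD (straddleF X) (straddleF Y).
apply: iff_trans (iff_trans _ (dual _ _ _)) _.
- split=> H p; first by have /andP[p0 p1] := svalP p; exact: H.
  move=> p0 p1; have p01 : 0 < p < 1 by rewrite p0.
  exact: (H (mkI p01)).
- move=> m n mn; apply/subsetPset => t Ft; have Dt := FD _ _ Ft; move: Ft.
  rewrite !FE// /=; exact: le_lt_trans (u_nonincreasing mn).
- apply/seteqP; split=> [t [n _]|t Dt]; first exact: FD.
  have /u_small[n nt] : 0 < t by move: Dt; rewrite /D/= in_itv/= => /andP[].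
  by exists n => //; rewrite FE.
- move=> w; have [qw|[p qw]|qw] := lquantile_trichotomy X w.
  + exact: Or31.
  + apply: Or32; exists p; split=> [t Ft|t Dt].
      have Dt := FD _ _ Ft; move: Ft; rewrite FE// => pt.
      by apply: ltW; rewrite ltNge qw// -ltNge.
    by rewrite FE// qw// => /negP; rewrite -leNgt.
  + by apply: Or33 => t Dt; exact: ltW (qw t Dt).
by split=> H w; have := H w; rewrite !posE.
Qed.

(** The duality is applied to [- q] on the sets []0, p]]. Closed at [p], they are the sublevel sets
    that the Galois connection produces. Negation exchanges the two sides, which accounts for [Y]
    coming first. *)
Lemma lquantile_lower_duality X Y :
  (forall p : R, 0 < p -> p < 1 ->
    ele_conv (\int[lebesgue_measure]_(t in (`]0%R, p[ : set R)) (lquantile P Y t)%:E)%E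
             (\int[lebesgue_measure]_(t in (`]0%R, p[ : set R)) (lquantile P X t)%:E)%E) <->
  (forall w : R,
    ele_conv (\int[P]_s (neg_part (X s - w))%:E)%E (\int[P]_s (neg_part (Y s - w))%:E)%E).
Proof.
have negE (Z : {RV P >-> R}) w : (\int[P]_s (neg_part (Z s - w))%:E =
    \int[lebesgue_measure]_(t in D) (pos_part (- lquantile P Z t - - w))%:E)%E.
  rewrite (@integral_RV Z (fun x => neg_part (x - w))).
  - by apply: eq_integral => t _; rewrite /neg_part /pos_part opprD.
  - by apply: measurable_maxr => //; apply: measurable_funN; exact: measurable_funB.
  - by move=> x; exact: pos_part_ge0.
pose F (p : I) : set R := `]0%R, sval p]%classic.
have FE p t : D t -> F p t = (t <= sval p) :> Prop.
  by rewrite /F /D/= !in_itv/= => /andP[-> _].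
have FD p : F p `<=` D.
  move=> t; rewrite /F /D/= !in_itv/= => /andP[-> tp] /=.
  by apply: le_lt_trans tp _; have /andP[] := svalP p.
have straddleF (Z : {RV P >-> R}) (p : I) :
    exists v, straddles D (F p) (fun t => - lquantile P Z t) v.
  have p01 : sval p \in `]0, 1[ by rewrite in_itv/= (svalP p).
  exists (- lquantile P Z (sval p)); split => [t Ft|t Dt].
    have Dt := FD _ _ Ft; move: Ft; rewrite FE// => pt.
    by rewrite lerN2; exact: lquantile_nondecreasing.
  rewrite FE// => /negP; rewrite -ltNge => tp; rewrite lerN2.
  by apply: lquantile_nondecreasing => //; exact: ltW.
have mNq (Z : {RV P >-> R}) : measurable_fun D (fun t => - lquantile P Z t).
  by apply: measurable_funN; exact: measurable_lquantile.
have dual := @ele_conv_duality _ _ _ lebesgue_measure I F D (fun t => - lquantile P X t)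
  (fun t => - lquantile P Y t) (fun n => mkI (v01 n)) (measurable_itv _) lebesgueD (mNq X)
  (mNq Y) (fun p => measurable_itv _) FD (straddleF X) (straddleF Y).
have intE (Z : {RV P >-> R}) (p : I) : (\int[lebesgue_measure]_(t in F p) (- lquantile P Z t)%:E =
    - \int[lebesgue_measure]_(t in (`]0%R, sval p[ : set R)) (lquantile P Z t)%:E)%E.
  have mq : measurable_fun (F p) (lquantile P Z).
    by apply: measurable_funS (@measurable_lquantile _ _ _ P Z) => //; exact: FD.
  (* The endpoint [p] is a null set, so the open interval may be closed. *)
  rewrite (@integral_itv_bndo_bndc _ _ _ (fun t => (lquantile P Z t)%:E)); last first.
    apply/measurable_EFinP; apply: measurable_funS mq => [|t]; first exact: measurable_itv.
    by rewrite /F/= !in_itv/= => /andP[-> /ltW ->].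
  apply: (@integralN_le_cst _ _ _ _ _ _ (lquantile P Z (sval p))) => //.
  - exact: measurable_itv.
  - apply: le_lt_trans lebesgueD; apply: le_measure; last exact: FD.
      by rewrite inE; exact: measurable_itv.
    by rewrite inE; exact: measurable_itv.
  move=> t Ft; have Dt := FD _ _ Ft; move: Ft; rewrite FE// => tp.
  by apply: lquantile_nondecreasing => //; rewrite in_itv/= (svalP p).
apply: iff_trans (iff_trans _ (dual _ _ _)) _.
- split=> H p.
    by have /andP[p0 p1] := svalP p; rewrite !intE; apply/ele_convN; exact: H.
  move=> p0 p1; have p01 : 0 < p < 1 by rewrite p0.
  by have := H (mkI p01); rewrite !intE => /ele_convN.
- move=> m n mn; apply/subsetPset => t Ft; have Dt := FD _ _ Ft; move: Ft.
  by rewrite !FE//= => /le_trans; apply; rewrite lerB// u_nonincreasing.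
- apply/seteqP; split=> [t [n _]|t Dt]; first exact: FD.
  have /u_small[n nt] : 0 < 1 - t.
    by move: Dt; rewrite /D/= in_itv/= subr_gt0 => /andP[].
  by exists n => //; rewrite FE//= lerBrDr -lerBrDl ltW.
(* Level [w] for [- q] is level [- w] for [q], and the two extreme cases trade places. *)
- move=> w; have [qw|[p qw]|qw] := lquantile_trichotomy X (- w).
  + by apply: Or33 => t Dt; rewrite lerNr qw.
  + apply: Or32; exists p; split=> [t Ft|t Dt].
      have Dt := FD _ _ Ft; move: Ft; rewrite FE// => pt.
      by rewrite lerNr qw.
    by rewrite FE// -qw// => /negP; rewrite -ltNge lerNl => /ltW.
  + by apply: Or31 => t Dt; rewrite lerNl; exact: ltW (qw t Dt).
split=> H w; first by rewrite !negE.
by have := H (- w); rewrite !negE opprK.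
Qed.

End quantile_duality.

(** * Approximation of a convex function from below by sums of hinges *)

Section hinge_approximation.
Context {R : realType}.
Implicit Types (u v : R -> R) (x y z a h : R).

(** Convexity with weight [(z - y) / (z - x)], cleared of denominators. *)
Lemma convex_fun_three_points u x y z : convex_fun u -> x < y -> y <= z ->
  (z - x) * u y <= (z - y) * u x + (y - x) * u z.
Proof.
move=> cu xy yz; have zx : 0 < z - x by rewrite subr_gt0 (lt_le_trans xy).
have t0 : 0 <= (z - y) / (z - x) by rewrite divr_ge0 ?(ltW zx)// subr_ge0.
have t1 : (z - y) / (z - x) <= 1 by rewrite ler_pdivrMr// mul1r lerB// ltW.
have := cu x z _ t0 t1.
have -> : (z - y) / (z - x) * x + (1 - (z - y) / (z - x)) * z = y.
  by field; rewrite gt_eqF.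
rewrite -(ler_pM2l zx) => /le_trans; apply; rewrite le_eqVlt; apply/orP; left; apply/eqP.
by field; rewrite gt_eqF.
Qed.

Variables (v : R -> R) (a h : R).
Hypotheses (cv : convex_fun v) (ndv : {homo v : x y / x <= y}) (va : forall x, x <= a -> v x = 0).
Hypothesis h0 : 0 < h.

Definition grid (k : nat) : R := a + k%:R * h.

(** The jump at [grid k - h] of the slope of the piecewise linear interpolant of [v], here placed at
    [grid k]. On the grid, [hinge_sum] thus interpolates [v] moved to the right by [h]; this shift
    is what puts it below [v]. *)
Definition hinge_weight (k : nat) : R :=
  (v (grid k) - 2 * v (grid k - h) + v (grid k - 2 * h)) / h.

Definition hinge_sum (n : nat) (x : R) : R :=
  \sum_(k < n) hinge_weight k * pos_part (x - grid k).

Lemma hinge_weight_ge0 k : 0 <= hinge_weight k.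
Proof.
rewrite divr_ge0 ?(ltW h0)//.
have := @convex_fun_three_points v (grid k - 2 * h) (grid k - h) (grid k) cv.
have -> : grid k - 2 * h < grid k - h by have := h0; lra.
have -> : grid k - h <= grid k by have := h0; lra.
move=> /(_ isT isT).
have -> : grid k - (grid k - 2 * h) = h * 2 by ring.
have -> : grid k - (grid k - h) = h by ring.
have -> : grid k - h - (grid k - 2 * h) = h by ring.
rewrite -mulrA -mulrDr ler_pM2l//; lra.
Qed.

Lemma gridS k : grid k.+1 = grid k + h.
Proof. by rewrite /grid -natr1; ring. Qed.

Lemma grid_nondecreasing k n : (k <= n)%N -> grid k <= grid n.
Proof. by move=> kn; rewrite lerD2l ler_pM2r// ler_nat. Qed.

(* Past the grid, [hinge_sum] is the chord of [v] through [grid n - 2 h] and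
   [grid n - h], moved to the right by [h]. *)
Lemma sum_hinge_weight n x :
  \sum_(k < n) hinge_weight k * (x - grid k) =
  v (grid n - 2 * h) + (v (grid n - h) - v (grid n - 2 * h)) / h * (x - grid n + h).
Proof.
elim: n => [|n IHn].
  rewrite big_ord0 (va (x := _ - 2 * h)) ?(va (x := _ - h)) ?subrr ?mul0r ?addr0//;
  by rewrite /grid; have := h0; lra.
rewrite big_ord_recr /= {}IHn gridS.
have -> : grid n + h - 2 * h = grid n - h by ring.
by rewrite addrK /hinge_weight; field; rewrite gt_eqF.
Qed.

Lemma hinge_sumS_le n x : x <= grid n -> hinge_sum n.+1 x = hinge_sum n x.
Proof.
move=> xn; rewrite /hinge_sum big_ord_recr /= [pos_part _]max_r ?mulr0 ?addr0//.
by rewrite subr_le0.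
Qed.

Lemma hinge_sumS_ge n x : grid n <= x ->
  hinge_sum n.+1 x = v (grid n - h) + (v (grid n) - v (grid n - h)) / h * (x - grid n).
Proof.
move=> nx; transitivity (\sum_(k < n.+1) hinge_weight k * (x - grid k)).
  apply: eq_bigr => k _; rewrite [pos_part _]max_l// subr_ge0.
  by apply: le_trans nx; apply: grid_nondecreasing; rewrite -ltnS.
rewrite sum_hinge_weight gridS addrK.
have -> : grid n + h - 2 * h = grid n - h by ring.
by congr (_ + _ * _); ring.
Qed.

Lemma hinge_sum_ge0 n x : 0 <= hinge_sum n x.
Proof. by apply: sumr_ge0 => k _; rewrite mulr_ge0 ?hinge_weight_ge0 ?pos_part_ge0. Qed.

Lemma flat_ge0 x : 0 <= v x.
Proof. by have [/va ->//|/ltW/ndv] := leP x a; rewrite va. Qed.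

(** Right of [grid n], the chord of [v] through [grid n - h] and [grid n], prolonged, lies below [v]
    by convexity, and moving a nondecreasing chord to the right lowers it further. Left of [grid n],
    the last hinge vanishes. *)
Lemma hinge_sum_le n x : hinge_sum n x <= v x.
Proof.
elim: n => [|n IHn]; first by rewrite /hinge_sum big_ord0 flat_ge0.
have [xn|xn] := leP x (grid n); first by rewrite hinge_sumS_le.
rewrite hinge_sumS_ge ?(ltW xn)//.
have nh : grid n - h < grid n by have := h0; lra.
have := convex_fun_three_points cv nh (ltW xn).
have -> : grid n - (grid n - h) = h by ring.
have := ndv (ltW nh); set A := v (grid n - h); set B := v (grid n); set C := v x => AB.
set r := x - grid n; have r0 : 0 < r by rewrite subr_gt0.
have -> : x - (grid n - h) = r + h by rewrite /r; ring.
move=> H; rewrite -(ler_pM2l h0).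
have -> : h * (A + (B - A) / h * r) = h * A + (B - A) * r by field; rewrite gt_eqF.
have : 0 <= h * (B - A) by rewrite mulr_ge0 ?subr_ge0// ltW.
nra.
Qed.

(** Between [grid n] and [grid n.+1] the sum is at least its value [v (grid n - h)] at the left end,
    and [x - 2 * h] is at most [grid n - h]. *)
Lemma le_hinge_sum n x : x <= grid n -> v (x - 2 * h) <= hinge_sum n x.
Proof.
elim: n => [|n IHn] xn.
  rewrite /hinge_sum big_ord0 va//; move: xn; rewrite /grid mul0r addr0; have := h0; lra.
have [xn'|/ltW nx] := leP x (grid n); first by rewrite hinge_sumS_le// IHn.
rewrite hinge_sumS_ge//; apply: (@le_trans _ _ (v (grid n - h))).
  by apply: ndv; move: xn; rewrite gridS; lra.
rewrite lerDl mulr_ge0 ?subr_ge0// divr_ge0 ?(ltW h0)// subr_ge0 ndv//.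
by have := h0; lra.
Qed.

End hinge_approximation.

(** * Cutting a convex function at a zero minimum *)

Lemma convex_pos_part {R : realType} (u : R -> R) (w : R) :
  convex_fun u -> convex_fun (fun x => pos_part (u x - w)).
Proof.
move=> cu x y t t0 t1; rewrite {1}/pos_part ge_max; apply/andP; split; last first.
  by rewrite addr_ge0// mulr_ge0 ?pos_part_ge0// subr_ge0.
have := cu x y t t0 t1.
have : t * (u x - w) <= t * pos_part (u x - w) by rewrite ler_wpM2l ?pos_part_ge.
have : (1 - t) * (u y - w) <= (1 - t) * pos_part (u y - w).
  by rewrite ler_wpM2l ?pos_part_ge// subr_ge0.
lra.
Qed.

Lemma convex_funN {R : realType} (u : R -> R) : convex_fun u -> convex_fun (fun x => u (- x)).
Proof.
move=> cu x y t t0 t1 /=.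
have -> : - (t * x + (1 - t) * y) = t * - x + (1 - t) * - y by ring.
exact: cu.
Qed.

Section zero_at_minimum.
Context {R : realType} (U : R -> R) (m : R).
Hypotheses (cU : convex_fun U) (U0 : forall x, 0 <= U x) (Um : U m = 0).

Lemma convex_nondecreasing_right x y : m <= x -> x <= y -> U x <= U y.
Proof.
rewrite le_eqVlt => /orP[/eqP <- _|mx xy]; first by rewrite Um U0.
have := convex_fun_three_points cU mx xy; rewrite Um mulr0 add0r => H.
have my : 0 < y - m by rewrite subr_gt0 (lt_le_trans mx).
rewrite -(ler_pM2l my); apply: le_trans H _.
by rewrite ler_wpM2r// lerB.
Qed.

(** The right branch of [U], frozen at the minimum left of [m]. The left branch is the same
    construction for the mirror image of [U] at [- m]. *)
Let V x := U (Num.max x m).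

Lemma right_part_nondecreasing : {homo V : x y / x <= y}.
Proof.
move=> x y xy; apply: convex_nondecreasing_right; first by rewrite le_max lexx orbT.
by rewrite ge_max !le_max xy lexx orbT.
Qed.

Lemma convex_right_part : convex_fun V.
Proof.
move=> x y t t0 t1; apply: le_trans (cU _ _ t0 t1).
have s0 : 0 <= 1 - t by rewrite subr_ge0.
apply: convex_nondecreasing_right; first by rewrite le_max lexx orbT.
rewrite ge_max; apply/andP; split; first by rewrite lerD// ler_wpM2l// le_max lexx.
rewrite [leLHS](_ : m = t * m + (1 - t) * m); last by ring.
by rewrite lerD// ler_wpM2l// le_max lexx orbT.
Qed.

Lemma right_part_flat x : x <= m -> V x = 0.
Proof. by move=> xm; rewrite /V max_r. Qed.

Lemma right_part_le x : V x <= U x.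
Proof.
have [xm|/ltW mx] := leP x m; first by rewrite right_part_flat// U0.
by rewrite /V max_l.
Qed.

End zero_at_minimum.

(** * From hinges to truncated convex functions *)

Section transfer.
Context {d} {T : measurableType d} {R : realType} (P : probability T R).
Implicit Types (X Y Z : T -> R) (u v U : R -> R).

Lemma integral_hinge_sum_le v a h n X Y :
  convex_fun v -> {homo v : x y / x <= y} -> (forall x, x <= a -> v x = 0) -> 0 < h ->
  measurable_fun setT X -> measurable_fun setT Y ->
  P.-integrable setT (EFin \o (v \o X)) ->
  (forall w, ele_conv (\int[P]_s (pos_part (X s - w))%:E) (\int[P]_s (pos_part (Y s - w))%:E)) ->
  (\int[P]_s (hinge_sum v a h n (X s))%:E <= \int[P]_s (hinge_sum v a h n (Y s))%:E)%E.
Proof.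
move=> cv ndv va h0 mX mY vX XY.
have d0 k := hinge_weight_ge0 a cv h0 k.
have mpos (Z : T -> R) k : measurable_fun setT Z ->
  measurable_fun setT (fun s => (pos_part (Z s - grid a h k))%:E) by exact: measurable_pos_part.
have sumE (Z : T -> R) : measurable_fun setT Z -> (\int[P]_s (hinge_sum v a h n (Z s))%:E =
  \sum_(k < n) (hinge_weight v a h k)%:E * \int[P]_s (pos_part (Z s - grid a h k))%:E)%E.
  move=> mZ; under eq_integral do rewrite /hinge_sum -sumEFin.
  rewrite ge0_integral_sum//.
  - apply: eq_bigr => k _; under eq_integral do rewrite EFinM.
    apply: ge0_integralZl_EFin => //; last exact: mpos.
    by move=> s _; rewrite lee_fin pos_part_ge0.
  - move=> k; under eq_fun do rewrite EFinM.
    by apply: emeasurable_funM => //; exact: mpos.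
  - by move=> k s _; rewrite lee_fin mulr_ge0 ?pos_part_ge0.
rewrite !sumE//; apply: lee_sum => k _.
(* A hinge of weight 0 may have infinite expectation, but its term is 0. One of positive weight is
   dominated by [v] up to that factor, so its expectation at [X] is finite and the convention gives
   a true inequality. *)
have := d0 k; rewrite le_eqVlt => /orP[/eqP <-|dk]; first by rewrite !mul0e.
rewrite lee_pmul2l//; apply: (ele_conv_le (XY _)); last first.
  apply: (@lt_le_trans _ _ 0%E) => //; apply: integral_ge0 => s _.
  by rewrite lee_fin pos_part_ge0.
rewrite -(@lte_pmul2l _ (hinge_weight v a h k)%:E)//.
rewrite -ge0_integralZl_EFin//; [|by move=> s _; rewrite lee_fin pos_part_ge0|exact: mpos].
rewrite gt0_muley ?lte_fin//.
apply: le_lt_trans (integrable_lty measurableT vX).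
apply: ge0_le_integral => //.
- by move=> s _; rewrite -EFinM lee_fin mulr_ge0 ?pos_part_ge0.
- by apply: emeasurable_funM => //; exact: mpos.
- exact: measurable_int vX.
(* The weighted hinge is the last term of [hinge_sum k.+1], whose other terms are nonnegative. *)
move=> s _; rewrite -EFinM lee_fin; apply: le_trans (hinge_sum_le cv ndv va h0 k.+1 _).
rewrite /hinge_sum big_ord_recr /= lerDr.
exact: (hinge_sum_ge0 a cv h0 k).
Qed.

Lemma measurable_hinge_sum v a h n : measurable_fun setT (hinge_sum v a h n).
Proof.
rewrite /hinge_sum; apply: measurable_sum => k.
by apply: measurable_funM => //; apply: measurable_maxr => //; exact: measurable_funB.
Qed.

Lemma flat_transfer v a X Y :
  convex_fun v -> {homo v : x y / x <= y} -> (forall x, x <= a -> v x = 0) ->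
  measurable_fun setT X -> measurable_fun setT Y ->
  P.-integrable setT (EFin \o (v \o X)) ->
  (forall w, ele_conv (\int[P]_s (pos_part (X s - w))%:E) (\int[P]_s (pos_part (Y s - w))%:E)) ->
  (\int[P]_s (v (X s))%:E <= \int[P]_s (v (Y s))%:E)%E.
Proof.
move=> cv ndv va mX mY vX XY.
pose h (n : nat) : R := n.+1%:R^-1.
have h0 n : 0 < h n by rewrite invr_gt0 ltr0n.
(* With mesh [1 / n.+1], this number of hinges takes the grid up to [a + n.+1], so the mesh shrinks
   while the grid eventually passes every point. *)
pose G n := hinge_sum v a (h n) (n.+1 * n.+1).
have gridE n : grid a (h n) (n.+1 * n.+1) = a + n.+1%:R.
  by rewrite /grid natrM mulfK// pnatr_eq0.
have v0 x : 0 <= v x by apply: (flat_ge0 ndv va).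
have mv : measurable_fun setT v by exact: nondecreasing_measurable.
have Gv x : (G n x @[n --> \oo] --> v x)%classic.
  (* By convexity the slope on [[x - 2 h, x]] is at most the slope on [[x, x + 1]], so
     [v x - v (x - 2 h)] is at most [C * h]. *)
  pose C := 2 * (v (x + 1) - v x).
  apply: (@squeeze_cvgr _ _ _ _ (fun n => v x - C * harmonic n) (cst (v x))).
  - near=> n; rewrite (hinge_sum_le cv ndv va (h0 n)) andbT.
    have xn : x <= grid a (h n) (n.+1 * n.+1).
      rewrite gridE -lerBlDl; near: n; exists (Num.bound (x - a)) => // n /= xn.
      by apply: le_trans (ltW (unstable.ltr_bound _)) _; rewrite ler_nat ltnW.
    apply: le_trans (le_hinge_sum ndv va (h0 n) xn).
    have hn0 := h0 n.
    have x1 : x - 2 * h n < x by lra.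
    have x2 : x <= x + 1 by lra.
    have := convex_fun_three_points cv x1 x2.
    have -> : x + 1 - (x - 2 * h n) = 1 + 2 * h n by ring.
    have -> : x + 1 - x = 1 by ring.
    have -> : x - (x - 2 * h n) = 2 * h n by ring.
    rewrite /C -[harmonic n]/(h n) => H.
    suff : 2 * (v (x + 1) - v x) * h n = 2 * h n * v (x + 1) - 2 * h n * v x.
      by move=> ->; move: H; rewrite mulrDl !mul1r; lra.
    by ring.
  - rewrite -[X in _ --> X]subr0 -[X in _ --> _ - X](mulr0 C).
    by apply: cvgB; [exact: cvg_cst|apply: cvgMr; exact: cvg_harmonic].
  - exact: cvg_cst.
have mG n : measurable_fun setT (fun s => (G n (X s))%:E).
  by apply/measurable_EFinP; apply: measurableT_comp => //; exact: measurable_hinge_sum.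
have cvG : {ae P, forall s, setT s -> (G n (X s))%:E @[n --> \oo] --> (v (X s))%:E}.
  by apply: aeW => s _; apply: cvg_EFin; [exact: nearW|exact: Gv].
have domG : {ae P, forall s n, setT s -> (`|(G n (X s))%:E| <= (v (X s))%:E)%E}.
  apply: aeW => s n _; rewrite gee0_abs lee_fin ?(hinge_sum_ge0 a cv (h0 n))//.
  exact: (hinge_sum_le cv ndv va (h0 n)).
have mvX : measurable_fun setT (fun s => (v (X s))%:E) by exact: measurable_int vX.
have [_ _ lim] := dominated_convergence measurableT mG mvX cvG vX domG.
apply: cvge_le lim; apply: nearW => n /=.
apply: le_trans (integral_hinge_sum_le _ cv ndv va (h0 n) mX mY vX XY) _.
apply: ge0_le_integral => //.
- by move=> s _; rewrite lee_fin (hinge_sum_ge0 a cv (h0 n)).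
- by apply/measurable_EFinP; apply: measurableT_comp => //; exact: measurable_hinge_sum.
- by apply/measurable_EFinP; exact: measurableT_comp.
by move=> s _; rewrite lee_fin (hinge_sum_le cv ndv va (h0 n)).
Unshelve. all: by end_near. Qed.

Lemma integrable_le_comp (f g : T -> R) : measurable_fun setT f ->
  (forall s, 0 <= f s <= g s) -> P.-integrable setT (EFin \o g) -> P.-integrable setT (EFin \o f).
Proof.
move=> mf fg; apply: le_integrable => //; first exact/measurable_EFinP.
move=> s _ /=; have /andP[f0 fgs] := fg s.
by rewrite lee_fin !ger0_norm// (le_trans f0).
Qed.

Lemma pos_part_opp_le X Y :
  (forall w, ele_conv (\int[P]_s (neg_part (X s - w))%:E) (\int[P]_s (neg_part (Y s - w))%:E)) ->
  forall w, ele_conv (\int[P]_s (pos_part (- X s - w))%:E) (\int[P]_s (pos_part (- Y s - w))%:E).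
Proof.
have negE Z w : (\int[P]_s (pos_part (- Z s - w))%:E = \int[P]_s (neg_part (Z s - - w))%:E)%E.
  by apply: eq_integral => s _; rewrite /neg_part /pos_part opprK opprD.
by move=> XY w; rewrite !negE.
Qed.

Lemma truncated_transfer u m X Y :
  convex_fun u -> measurable_fun setT X -> measurable_fun setT Y ->
  P.-integrable setT (EFin \o (u \o X)) ->
  (forall w, ele_conv (\int[P]_s (neg_part (X s - w))%:E) (\int[P]_s (neg_part (Y s - w))%:E) /\
             ele_conv (\int[P]_s (pos_part (X s - w))%:E) (\int[P]_s (pos_part (Y s - w))%:E)) ->
  (\int[P]_s (pos_part (u (X s) - u m))%:E <= \int[P]_s (pos_part (u (Y s) - u m))%:E)%E.
Proof.
move=> cu mX mY uX XY.
pose U x := pos_part (u x - u m).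
have cU : convex_fun U := convex_pos_part (u m) cu.
have U0 x : 0 <= U x := pos_part_ge0 _.
have Um : U m = 0 by rewrite /U subrr /pos_part maxxx.
pose U' x := U (- x).
have cU' : convex_fun U' := convex_funN cU.
have U'0 x : 0 <= U' x := U0 _.
have U'm : U' (- m) = 0 by rewrite /U' opprK.
pose V x := U (Num.max x m); pose W (x : R) := U' (Num.max x (- m)).
(* On each side of [m] one summand is [U x] and the other is the value of [U] at [m], which is 0. *)
have UE x : U x = V x + W (- x).
  rewrite /V /W /U'; have [xm|/ltW mx] := leP x m.
    by rewrite Um add0r max_l ?opprK// lerN2.
  by rewrite [Num.max (- x) _]max_r ?lerN2// opprK Um addr0.
have mV : measurable_fun setT V.
  by apply: nondecreasing_measurable => //; exact: right_part_nondecreasing cU U0 Um.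
have mW : measurable_fun setT W.
  by apply: nondecreasing_measurable => //; exact: right_part_nondecreasing cU' U'0 U'm.
have splitE Z : measurable_fun setT Z -> (\int[P]_s (U (Z s))%:E =
    \int[P]_s (V (Z s))%:E + \int[P]_s (W (- Z s))%:E)%E.
  move=> mZ; under eq_integral do rewrite UE EFinD.
  apply: ge0_integralD => //.
  - by move=> s _; rewrite lee_fin U0.
  - by apply/measurable_EFinP; exact: measurableT_comp.
  - by move=> s _; rewrite lee_fin U'0.
  - apply/measurable_EFinP; apply: (measurableT_comp mW); exact: measurable_funN.
have UX : P.-integrable setT (EFin \o (U \o X)).
  have mUX : measurable_fun setT (U \o X).
    apply: measurable_maxr => //; apply: measurable_funB => //.
    by apply/measurable_EFinP; exact: measurable_int uX.
  apply: (@integrable_le_comp _ (fun s => `|u (X s)| + `|u m|)) => // [s|].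
    rewrite U0 /= /U /pos_part ge_max addr_ge0// andbT.
    by rewrite lerD ?ler_norm// -normrN ler_norm.
  have -> : EFin \o (fun s => `|u (X s)| + `|u m|) =
     ((EFin \o (fun s => `|u (X s)|)%R) \+ (EFin \o cst `|u m|%R))%E by [].
  by apply: integrableD => //; [exact: integrable_norm|exact: finite_measure_integrable_cst].
suff : (\int[P]_s (U (X s))%:E <= \int[P]_s (U (Y s))%:E)%E by [].
rewrite (splitE _ mX) (splitE _ mY); apply: leeD.
- apply: (@flat_transfer V m) => //.
  + exact: convex_right_part.
  + exact: right_part_nondecreasing.
  + exact: right_part_flat.
  + apply: integrable_le_comp UX; first exact: measurableT_comp.
    by move=> s; rewrite U0 /= right_part_le.
  + by move=> w; have [] := XY w.
- apply: (@flat_transfer W (- m) (fun s => - X s) (fun s => - Y s)) => //.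
  + exact: convex_right_part.
  + exact: right_part_nondecreasing.
  + exact: right_part_flat.
  + exact: measurable_funN.
  + exact: measurable_funN.
  + apply: integrable_le_comp UX.
      by apply: (measurableT_comp mW); exact: measurable_funN.
    by move=> s; rewrite U'0 /= (le_trans (right_part_le U'0 U'm _))// /U' opprK.
  + by apply: pos_part_opp_le => w; have [] := XY w.
Qed.

End transfer.

(** * Removal of the truncation, and the equivalence with the hinge order *)

Section convex_order.
Context {d} {T : measurableType d} {R : realType} (P : probability T R).

Lemma integrable_max_cst (f : T -> R) (c : R) : P.-integrable setT (EFin \o f) ->
  P.-integrable setT (EFin \o (fun s => Num.max (f s) c)).
Proof.
move=> fi; have fc : P.-integrable setT (fun s => `|(f s)%:E| + (EFin \o cst `|c|%R) s)%E.
  apply: integrableD => //; first exact: integrable_abse fi.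
  exact: finite_measure_integrable_cst.
apply: le_integrable fc => //.
  apply/measurable_EFinP; apply: measurable_maxr => //.
  by apply/measurable_EFinP; exact: measurable_int fi.
move=> s _ /=; rewrite lee_fin [leRHS]ger0_norm ?addr_ge0//.
by have [_|_] := leP (f s) c; rewrite ?lerDl ?lerDr.
Qed.

(** The truncation is discarded at [X], where [u - u m] is below its positive part, and kept at [Y],
    where adding [u m] back turns the positive part into a maximum. *)
Lemma convex_transfer_max (u : R -> R) (m : R) (X Y : T -> R) :
  convex_fun u -> measurable_fun setT X -> measurable_fun setT Y ->
  P.-integrable setT (EFin \o (u \o X)) -> P.-integrable setT (EFin \o (u \o Y)) ->
  (forall w, ele_conv (\int[P]_s (neg_part (X s - w))%:E) (\int[P]_s (neg_part (Y s - w))%:E) /\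
             ele_conv (\int[P]_s (pos_part (X s - w))%:E) (\int[P]_s (pos_part (Y s - w))%:E)) ->
  (\int[P]_s (u (X s))%:E <= \int[P]_s (Num.max (u (Y s)) (u m))%:E)%E.
Proof.
move=> cu mX mY uX uY XY; have Pfin : (P setT < +oo)%E by rewrite probability_setT ltry.
have mu_X : measurable_fun setT (u \o X) by apply/measurable_EFinP; exact: measurable_int uX.
have mu_Y : measurable_fun setT (u \o Y) by apply/measurable_EFinP; exact: measurable_int uY.
have maxY := integrable_max_cst (u m) uY.
have := integral_le_pos_part (u m) measurableT measurableT (@subset_refl _ setT) Pfin mu_X uX.
move=> /le_trans /(_ (truncated_transfer m cu mX mY uX XY)).
have -> : (\int[P]_s (pos_part (u (Y s) - u m))%:E =
           \int[P]_s (Num.max (u (Y s)) (u m) - u m)%:E)%E.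
  by apply: eq_integral => s _; rewrite /pos_part addr_maxl subrr.
rewrite (integralB_cst (f := fun s => Num.max (u (Y s)) (u m)))//.
rewrite leeD2rE// fin_numN fin_numM// ge0_fin_numE//.
Qed.

(* [max (u Y) (u m)] approaches [u Y] as [u m] decreases to the infimum of [u]. *)
Lemma convex_transfer (u : R -> R) (X Y : T -> R) :
  convex_fun u -> measurable_fun setT X -> measurable_fun setT Y ->
  P.-integrable setT (EFin \o (u \o X)) -> P.-integrable setT (EFin \o (u \o Y)) ->
  (forall w, ele_conv (\int[P]_s (neg_part (X s - w))%:E) (\int[P]_s (neg_part (Y s - w))%:E) /\
             ele_conv (\int[P]_s (pos_part (X s - w))%:E) (\int[P]_s (pos_part (Y s - w))%:E)) ->
  (\int[P]_s (u (X s))%:E <= \int[P]_s (u (Y s))%:E)%E.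
Proof.
move=> cu mX mY uX uY XY.
have key m := convex_transfer_max m cu mX mY uX uY XY.
have mu_Y : measurable_fun setT (u \o Y) by apply/measurable_EFinP; exact: measurable_int uY.
have mmax m : measurable_fun setT (fun s => (Num.max (u (Y s)) (u m))%:E).
  by apply/measurable_EFinP; exact: measurable_maxr.
(* If [u] is bounded below, a point [m] with [u m] within [e] of the infimum makes the maximum at
   most [u (Y s) + e]. Otherwise [u (m n) <= - n] and dominated convergence applies. *)
have [[c uc]|unb] := pselect (exists c, forall x, c <= u x).
  apply/lee_addgt0Pr => e e0.
  have [_ [m _ <-] me] : exists2 y, range u y & y < inf (range u) + e.
    by apply: inf_adherent => //; split; [exists (u 0), 0|exists c => _ [x _ <-]].
  apply: le_trans (key m) _.
  have -> : (\int[P]_s (u (Y s))%:E + e%:E = \int[P]_s ((u (Y s))%:E + (EFin \o cst e) s))%E.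
    rewrite integralD//; last exact: finite_measure_integrable_cst.
    rewrite -[in LHS](mule1 e%:E) -(probability_setT P); congr (_ + _)%E.
    by symmetry; exact: (integral_cst P measurableT e%:E).
  apply: le_integral => //.
  - exact: integrable_max_cst.
  - by apply: integrableD => //; exact: finite_measure_integrable_cst.
  move=> s _; rewrite /= -EFinD lee_fin ge_max lerDl (ltW e0) /=.
  apply: le_trans (ltW me) _; rewrite lerD2r; apply: ge_inf; last by exists (Y s).
  by exists c => _ [x _ <-].
have /choice[m um] : forall n : nat, exists x, u x <= - n%:R.
  move=> n; apply: contrapT => nu; apply: unb; exists (- n%:R) => x.
  by rewrite leNgt; apply/negP => xn; apply: nu; exists x; exact: ltW.
have cvgm : {ae P, forall s, setT s ->
    (Num.max (u (Y s)) (u (m n)))%:E @[n --> \oo] --> (u (Y s))%:E}.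
  apply: aeW => s _; apply: cvg_near_cst; exists (Num.bound (u (Y s))) => // n /= sn.
  rewrite max_l//; apply: le_trans (um n) _; rewrite lerNl.
  by apply: le_trans (ltW (unstable.ltrNbound _)) _; rewrite ler_nat.
have domm : {ae P, forall s n, setT s ->
    (`|(Num.max (u (Y s)) (u (m n)))%:E| <= `|(u (Y s))%:E|)%E}.
  (* Where the maximum differs from [u (Y s)], it lies between [u (Y s)] and 0, since [u (m n)] is
     nonpositive. *)
  apply: aeW => s n _; rewrite /= lee_fin; have [//|lt_uY] := leP (u (m n)) (u (Y s)).
  have um0 : u (m n) <= 0 by apply: le_trans (um n) _; rewrite oppr_le0.
  by rewrite (ler0_norm um0) (ler0_norm (le_trans (ltW lt_uY) um0)) lerN2 ltW.
have [_ _ lim] := dominated_convergence measurableT (fun n => mmax (m n))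
  (measurable_int _ uY) cvgm (integrable_abse uY) domm.
by apply: cvge_ge lim; apply: nearW => n; exact: key.
Qed.

Lemma dagger_cxP (X Y : {RV P >-> R}) :
  dagger_cx P X Y <->
  (forall w : R,
    ele_conv (\int[P]_s (neg_part (X s - w))%:E)%E (\int[P]_s (neg_part (Y s - w))%:E)%E /\
    ele_conv (\int[P]_s (pos_part (X s - w))%:E)%E (\int[P]_s (pos_part (Y s - w))%:E)%E).
Proof.
split=> [XY w|XY u cu uX uY]; last exact: convex_transfer.
have hinge (h : R -> R) : convex_fun h -> measurable_fun setT h -> (forall x, 0 <= h x) ->
    ele_conv (\int[P]_s (h (X s))%:E)%E (\int[P]_s (h (Y s))%:E)%E.
  (* For a nonnegative [h], the two finite expectations left by the convention are exactly the
     integrability that [dagger_cx] requires. *)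
  move=> ch mh h0; apply: ele_conv_lty => Xoo Yoo.
  have intP (Z : {RV P >-> R}) : (\int[P]_s (h (Z s))%:E < +oo)%E ->
      P.-integrable setT (EFin \o (h \o Z)).
    move=> Zoo; apply/integrableP; split.
      by apply/measurable_EFinP; exact: measurableT_comp.
    by under eq_integral do rewrite /= ger0_norm//.
  by apply: XY => //; exact: intP.
have cid : convex_fun (@id R) by [].
split; last first.
  apply: (hinge (fun x => pos_part (x - w))); last by move=> x; exact: pos_part_ge0.
    exact: (convex_pos_part w cid).
  by apply: measurable_maxr => //; exact: measurable_funB.
apply: (hinge (fun x => neg_part (x - w))); last by move=> x; exact: pos_part_ge0.
  have -> : (fun x => neg_part (x - w)) = (fun x => pos_part (- x - - w)).
    by apply/funext => x; rewrite /neg_part /pos_part opprD.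
  exact: (convex_funN (convex_pos_part (- w) cid)).
by apply: measurable_maxr => //; apply: measurable_funN; exact: measurable_funB.
Qed.

End convex_order.

Theorem theorem2 (d : measure_display) (T : measurableType d) (R : realType)
  (P : probability T R) (X Y : {RV P >-> R}) :
  atomless P ->
  (dagger_cx P X Y <->
     (forall p : R, 0 < p -> p < 1 ->
        ele_conv (\int[lebesgue_measure]_(t in (`]0%R, p[ : set R)) (lquantile P Y t)%:E)%E
                 (\int[lebesgue_measure]_(t in (`]0%R, p[ : set R)) (lquantile P X t)%:E)%E
        /\
        ele_conv (\int[lebesgue_measure]_(t in (`]p, 1%R[ : set R)) (lquantile P X t)%:E)%E
                 (\int[lebesgue_measure]_(t in (`]p, 1%R[ : set R)) (lquantile P Y t)%:E)%E))
  /\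
  (dagger_cx P X Y <->
     (forall w : R,
        ele_conv (\int[P]_s (neg_part (X s - w))%:E)%E
                 (\int[P]_s (neg_part (Y s - w))%:E)%E
        /\
        ele_conv (\int[P]_s (pos_part (X s - w))%:E)%E
                 (\int[P]_s (pos_part (Y s - w))%:E)%E)).
Proof.
move=> _; split; apply: iff_trans (dagger_cxP X Y) _; last by [].
have lower := lquantile_lower_duality X Y.
have upper := lquantile_upper_duality X Y.
split=> H.
  have H1 := iffRL lower (fun w => proj1 (H w)).
  have H2 := iffRL upper (fun w => proj2 (H w)).
  by move=> p p0 p1; split; [exact: H1|exact: H2].
move=> w; split.
  by apply: (iffLR lower) => p p0 p1; have [] := H p p0 p1.
by apply: (iffLR upper) => p p0 p1; have [] := H p p0 p1.
Qed.
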